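(* For all real numbers $a,b >0$ and every integer $m \geq 1$, $$L(a,b) \ge \frac{1}{m}\sum_{k=1}^m a^{\frac{2k-1}{2m}} b^{\frac{2m-(2k-1)}{2m}} \ge \frac{1}{m}\sum_{k=1}^m a^{\frac{k}{m+1}} b^{\frac{m+1-k}{m+1}} \ge \sqrt{ab}.$$
   Context: For positive real numbers $a,b$, $L(a,b)$ denotes the logarithmic mean: $L(a,b) = \frac{a-b}{\log a-\log b} = \int_0^1 a^{\nu} b^{1-\nu}\, d\nu$ if $a\neq b$, and $L(a,b)=a$ if $a=b$. *)

(* Defs.v *)
From mathcomp Require Import all_boot all_order all_algebra.
From mathcomp Require Import all_classical all_reals all_analysis.

Set Implicit Arguments.
Unset Strict Implicit.
Unset Printing Implicit Defensive.

Import Order.TTheory GRing.Theory Num.Theory.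
Local Open Scope ring_scope.

(* The logarithmic mean; only meaningful for [0 < a] and [0 < b], since [ln]
   is [0] on nonpositive reals. *)
Definition logmean (R : realType) (a b : R) : R :=
  if a == b then a else (a - b) / (ln a - ln b).

(* Main.v *)
(** With [g = sqrt (a b)] and [d = ln a - ln b], each term [a^p b^(1-p)] equals
    [g e^((p - 1/2) d)], so both middle quantities are [g/m] times the centered
    sum [S_m(y) = \sum_(1 <= k <= m) e^((2k-1-m) y)], taken at [y = d/(2m)] and at
    [y = d/(2(m+1))], while [sqrt (a b)] corresponds to [y = 0].  Reversing the
    sum shows [S_m(y) = \sum_k cosh ((2k-1-m) y)], which is nondecreasing in
    [|y|].  The logarithmic mean is [g sinh(m y) / (m y)] at [y = d/(2m)], and
    [sinh (m y) = S_m(y) sinh y] by telescoping, so the first inequality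
    reduces to [sinh y / y >= 1]. *)
Require Import Defs.
From mathcomp Require Import all_boot all_order all_algebra.
From mathcomp Require Import all_classical all_reals all_analysis.
From mathcomp Require Import ring lra.

Set Implicit Arguments.
Unset Strict Implicit.
Unset Printing Implicit Defensive.

Import Order.TTheory GRing.Theory Num.Theory.
Local Open Scope ring_scope.

(** By evenness take absolute values. With [u] $= e^{|x|}$ and [v] $= e^{|y|}$ the difference
    factors as $(v-u)(1-1/(uv))$, and $1 \le u \le v$ makes both factors nonnegative. *)
Lemma expR_addN_le (R : realType) (x y : R) :
  `|x| <= `|y| -> expR x + expR (- x) <= expR y + expR (- y).
Proof.
have norm (z : R) : expR z + expR (- z) = expR `|z| + expR (- `|z|).
  by case: (ger0P z) => // _; rewrite opprK addrC.
move=> xy; rewrite (norm x) (norm y) !expRN.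
have x1 : 1 <= expR `|x| by rewrite -expR0 ler_expR.
have y1 : expR `|x| <= expR `|y| by rewrite ler_expR.
move: (expR `|x|) (expR `|y|) x1 y1 => u v u1 uv.
rewrite -subr_ge0.
have -> : v + v^-1 - (u + u^-1) = (v - u) * (1 - (u * v)^-1).
  by field; apply/andP; split; apply: lt0r_neq0; lra.
apply: mulr_ge0; first lra.
by rewrite subr_ge0 invf_le1; nra.
Qed.

(** Mean value theorem on $[0,x]$: the derivative $e^c + e^{-c}$ is at least its value 2 at $c =
    0$. *)
Lemma mul2_le_expR_subN (R : realType) (x : R) :
  0 <= x -> 2 * x <= expR x - expR (- x).
Proof.
move=> x0.
pose f (z : R) := expR z - expR (- z).
have df (z : R) : is_derive z 1 f (expR z + expR (- z)).
  have dN : is_derive z 1 (fun t : R => expR (- t)) (expR (- z) * -1).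
    exact: (is_derive1_comp (f := expR) (g := -%R)).
  apply: (is_derive_eq (is_deriveB (is_derive_expR z) dN)).
  by rewrite mulrN1 opprK.
have cf : {within `[0, x], continuous f}%classic.
  apply: continuous_subspaceT => z.
  by apply: differentiable_continuous; apply/derivable1_diffP; case: (df z).
have [c _] := MVT_segment x0 (fun z _ => df z) cf.
rewrite /f subr0 oppr0 subrr subr0 => ->.
apply: ler_wpM2r => //.
have := @expR_addN_le R 0 c; rewrite normr0 oppr0 expR0 normr_ge0.
by move=> /(_ isT); lra.
Qed.

Lemma ge1_expR_subN_div (R : realType) (x : R) :
  x != 0 -> 1 <= (expR x - expR (- x)) / (2 * x).
Proof.
case: (ltgtP x 0) => // x0 _.
  (* The quotient is even, so negative [x] is handled through [- x]; clearing the negative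
     denominator reverses the inequality. *)
  have := @mul2_le_expR_subN R (- x); rewrite opprK => /(_ _).
  rewrite ler_ndivlMr; first by rewrite mul1r => /(_ ltac:(lra)); lra.
  lra.
rewrite ler_pdivlMr; last lra.
by rewrite mul1r mul2_le_expR_subN// ltW.
Qed.

Definition centered_sum (R : realType) (m : nat) (y : R) : R :=
  \sum_(1 <= k < m.+1) expR ((2 * k%:R - 1 - m%:R) * y).

Lemma centered_sum0 (R : realType) (m : nat) : centered_sum m (0 : R) = m%:R.
Proof.
rewrite /centered_sum; under eq_bigr do rewrite mulr0 expR0.
by rewrite sumr_const_nat subSS subn0.
Qed.

Lemma centered_sumN (R : realType) (m : nat) (y : R) :
  centered_sum m y =
  \sum_(1 <= k < m.+1) expR (- ((2 * k%:R - 1 - m%:R) * y)).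
Proof.
(* The reversal $k \mapsto m+1-k$ negates $2k-1-m$. *)
rewrite /centered_sum big_nat_rev/=; apply: eq_big_nat => k /andP[k1 km].
by rewrite addSn subSS add0n natrB 1?ltnW// -[m.+1]addn1 natrD; congr expR; ring.
Qed.

Lemma centered_sum_le (R : realType) (m : nat) (x y : R) :
  `|x| <= `|y| -> centered_sum m x <= centered_sum m y.
Proof.
move=> xy.
(* Doubling allows each sum to be added to its own reversal, after which the comparison is
   termwise. *)
suff: centered_sum m x *+ 2 <= centered_sum m y *+ 2 by rewrite lerMn2r.
have fold z : centered_sum m z *+ 2 = \sum_(1 <= k < m.+1)
    (expR ((2 * k%:R - 1 - m%:R) * z) + expR (- ((2 * k%:R - 1 - m%:R) * z))).
  by rewrite mulr2n {2}centered_sumN -big_split.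
rewrite !fold.
apply: ler_sum => k _; apply: expR_addN_le.
by rewrite !normrM ler_wpM2l.
Qed.

Lemma centered_sum_telescope (R : realType) (m : nat) (y : R) :
  (expR y - expR (- y)) * centered_sum m y =
  expR (m%:R * y) - expR (- (m%:R * y)).
Proof.
rewrite /centered_sum mulr_sumr.
(* The exponents $2k-2-m$ and $2k-m$ are the neighbours of $2k-1-m$; at the ends $k = 1$ and $k =
   m+1$ this function takes exponents $-my$ and $my$. *)
rewrite (telescope_sumr_eq (fun k : nat => expR ((2 * k%:R - 2 - m%:R) * y)))//.
  by congr (expR _ - expR _); rewrite -?(addn1 m) ?natrD; ring.
move=> k _; rewrite mulrBl -!expRD -[k.+1]addn1 natrD.
by congr (expR _ - expR _); ring.
Qed.

Lemma powR_mean (R : realType) (a b p q : R) : 0 < a -> 0 < b -> p + q = 1 ->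
  a `^ p * b `^ q = Num.sqrt (a * b) * expR ((p - 2^-1) * (ln a - ln b)).
Proof.
move=> a0 b0 pq; have -> : q = 1 - p by lra.
rewrite -powR12_sqrt ?mulr_ge0 ?ltW// /powR mulf_eq0 !gt_eqF//= lnM//.
by rewrite -!expRD; congr expR; lra.
Qed.

(** Stated for general exponents so that both middle sums are instances, differing only in the step
    [y]. *)
Lemma sum_powR_mean (R : realType) (a b y : R) (m : nat) (p q : nat -> R) :
    0 < a -> 0 < b -> (forall k, p k + q k = 1) ->
    (forall k, (p k - 2^-1) * (ln a - ln b) = (2 * k%:R - 1 - m%:R) * y) ->
  \sum_(1 <= k < m.+1) a `^ p k * b `^ q k =
  Num.sqrt (a * b) * centered_sum m y.
Proof.
move=> a0 b0 pq py; rewrite /centered_sum mulr_sumr.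
by apply: eq_bigr => k _; rewrite powR_mean// py.
Qed.

Lemma logmean_centered_sum (R : realType) (a b : R) (m : nat) :
    0 < a -> 0 < b -> (0 < m)%N -> a != b ->
  let y := (ln a - ln b) / (2 * m%:R) in
  logmean a b = Num.sqrt (a * b) * (1 / m%:R * centered_sum m y) *
    ((expR y - expR (- y)) / (2 * y)).
Proof.
move=> a0 b0 m0 ab y.
have m_neq0 : m%:R != 0 :> R by rewrite pnatr_eq0 -lt0n.
have d_neq0 : ln a - ln b != 0 :> R.
  by rewrite subr_eq0; apply: contra ab => /eqP /ln_inj -> //; rewrite posrE.
have my : m%:R * y = (1 - 2^-1) * (ln a - ln b) by rewrite /y; field.
(* [a] and [b] are themselves the weighted means with $p = 1$ and $p = 0$. *)
have aE : a = Num.sqrt (a * b) * expR (m%:R * y).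
  by rewrite my -(powR_mean (q := 0)) ?addr0// powRr1 ?powRr0 ?mulr1// ltW.
have bE : b = Num.sqrt (a * b) * expR (- (m%:R * y)).
  rewrite my -mulNr (_ : - (1 - 2^-1) = 0 - 2^-1); last lra.
  by rewrite -(powR_mean (q := 1)) ?add0r// powRr1 ?powRr0 ?mul1r// ltW.
have abE : a - b = Num.sqrt (a * b) * (expR (m%:R * y) - expR (- (m%:R * y))).
  by rewrite mulrBr -aE -bE.
rewrite /logmean (negbTE ab) abE -centered_sum_telescope.
by move: (centered_sum m y) => S; rewrite /y; field; rewrite m_neq0.
Qed.

Theorem lemma2p5 (R : realType) (a b : R) (m : nat)
    (ha : 0 < a) (hb : 0 < b) (hm : (1 <= m)%N) :
  [/\ logmean a b >=
        1 / m%:R * \sum_(1 <= k < m.+1)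
          a `^ ((2 * k%:R - 1) / (2 * m%:R)) *
          b `^ ((2 * m%:R - (2 * k%:R - 1)) / (2 * m%:R)),
      1 / m%:R * \sum_(1 <= k < m.+1)
          a `^ ((2 * k%:R - 1) / (2 * m%:R)) *
          b `^ ((2 * m%:R - (2 * k%:R - 1)) / (2 * m%:R)) >=
        1 / m%:R * \sum_(1 <= k < m.+1)
          a `^ (k%:R / (m%:R + 1)) *
          b `^ ((m%:R + 1 - k%:R) / (m%:R + 1))
    & 1 / m%:R * \sum_(1 <= k < m.+1)
          a `^ (k%:R / (m%:R + 1)) *
          b `^ ((m%:R + 1 - k%:R) / (m%:R + 1)) >=
        Num.sqrt (a * b)].
Proof.
have m_gt0 : 0 < m%:R :> R by rewrite ltr0n.
have m_neq0 : m%:R != 0 :> R by rewrite gt_eqF.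
have m1_neq0 : m%:R + 1 != 0 :> R by rewrite natr1 pnatr_eq0.
have g_ge0 : 0 <= Num.sqrt (a * b) by exact: sqrtr_ge0.
pose d := ln a - ln b.
rewrite (@sum_powR_mean _ _ _ (d / (2 * m%:R)))//; last first.
- by move=> k; rewrite -/d; field; rewrite m_neq0.
- by move=> k; field; rewrite m_neq0.
rewrite (@sum_powR_mean _ _ _ (d / (2 * (m%:R + 1))))//; last first.
- by move=> k; rewrite -/d; field; rewrite m1_neq0.
- by move=> k; field; rewrite m1_neq0.
rewrite 2!(mulrCA (1 / m%:R)).
split.
- have [ab|ab] := eqVneq a b.
    rewrite /logmean /d ab eqxx subrr mul0r centered_sum0 mul1r mulVf// mulr1.
    by rewrite -expr2 sqrtr_sqr gtr0_norm.
  rewrite (logmean_centered_sum ha hb hm ab) ler_peMr//.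
    apply: mulr_ge0 => //; apply: mulr_ge0; first by rewrite divr_ge0// ltW.
    by apply: sumr_ge0 => k _; exact: expR_ge0.
  apply: ge1_expR_subN_div; rewrite mulf_neq0 ?invr_eq0 ?mulf_neq0//.
  by rewrite subr_eq0; apply: contra ab => /eqP /ln_inj -> //; rewrite posrE.
- apply: ler_wpM2l => //; apply: ler_wpM2l; first by rewrite divr_ge0// ltW.
  (* The factor $|d|$ cancels, whatever the sign of [d], leaving $1/(2(m+1)) \le 1/(2m)$. *)
  apply: centered_sum_le; rewrite !normrM ler_wpM2l// !gtr0_norm ?invr_gt0//.
  - by rewrite lef_pV2 ?posrE; lra.
  - lra.
(* After dividing by $\sqrt{ab}$ and clearing $1/m$, the left side $m$ is read as $S_m(0)$. *)
- rewrite ler_peMr// div1r ler_pdivlMl// mulr1 -[leLHS]centered_sum0.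
  by apply: centered_sum_le; rewrite normr0.
Qed.
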